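(* Let $A\in\mathbb{R}^{n\times n}$, $C\in\mathbb{R}^{p\times n}$, $Q\succ0$, $R\succ0$, and let $\gamma>0$. If $(A,Q^{1/2})$ is controllable and $(A,C)$ is detectable, then the solution $q^{opt}(\gamma)$ of the optimization problem $$q^{opt}(\gamma)=\min_{q}\ q\quad\text{subject to}\quad \mathrm{Tr}(X(q))\le\gamma,\quad q^c<q\le1,$$ where $X(q)$ is the positive semidefinite fixed point of $X=g_q(X)$, can be obtained (as the optimal value) by solving the following quasi-convex optimization problem in the variables $(q,G,H,Y)$: $$\begin{aligned}\min_{q,\,H,\,G\succ0,\,Y\succ0}\quad & q\\ \text{subject to}\quad & \mathrm{Tr}(Y)\le\gamma,\\ & \begin{bmatrix}Y&I\\ I&G\end{bmatrix}\succeq0,\\ & \Gamma_q(G,H)\succ0,\quad q^c<q\le1.\end{aligned}$$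
   Context: Here $G,Y$ are symmetric $n\times n$ matrices, $H\in\mathbb{R}^{n\times p}$, $I$ is the $n\times n$ identity, $'$ denotes transpose. For $X\succeq0$ and $q\in[0,1]$, $$g_q(X)=AXA'+Q-q\,AXC'(CXC'+R)^{-1}CXA'.$$ The critical value $q^c\in[0,1)$ depends on the unstable eigenvalues of $A$ and is the threshold such that, for $q\in(0,1]$, a positive semidefinite fixed point of $g_q$ exists if and only if $q>q^c$; it is known (earlier literature) that for $q\in(q^c,1]$ it is unique; it is denoted $X(q)$. Moreover $$\Gamma_q(G,H)=\begin{bmatrix} G & \sqrt{1-q}\,GA & \sqrt q\,(GA+HC) & \sqrt q\,H & G\\ (\cdot)' & G&0&0&0\\ (\cdot)'&(\cdot)'&G&0&0\\ (\cdot)'&(\cdot)'&(\cdot)'&R^{-1}&0\\ (\cdot)'&(\cdot)'&(\cdot)'&(\cdot)'&Q^{-1}\end{bmatrix},$$ where $(\cdot)'$ in position $(j,i)$ stands for the transpose of the block in position $(i,j)$. Convention: if the problem defining $q^{opt}(\gamma)$ is not feasible (e.g. $\gamma$ too small), one sets $q^{opt}(\gamma)=1$.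
   Formalization: Joint quasi-convexity in (q,G,H,Y) is false; proved: convexity at each fixed q and convex sublevel sets in (G,Y) after minimizing over q,H. Optimal values are infima; excluded is the case with the LMI problem infeasible and the trace problem feasible without minimizer, where equality fails. *)

(* Defs.v *)
From HB Require Import structures.
From mathcomp Require Import all_boot all_order all_algebra.
From mathcomp Require Import boolp classical_sets reals convex.
From mathcomp Require Import complex.

Set Implicit Arguments.
Unset Strict Implicit.
Unset Printing Implicit Defensive.

Import Order.TTheory GRing.Theory Num.Theory.

Local Open Scope classical_set_scope.
Local Open Scope ring_scope.

Section Matrices.
Variable F : realType.

Definition psdmx (n : nat) (M : 'M[F]_n) : Prop :=
  M^T = M /\ forall x : 'cV[F]_n, 0 <= (x^T *m M *m x) 0 0.

Definition pdmx (n : nat) (M : 'M[F]_n) : Prop :=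
  M^T = M /\ forall x : 'cV[F]_n, x != 0 -> 0 < (x^T *m M *m x) 0 0.

(* Every positive semidefinite Q has exactly one positive semidefinite square
   root, so for such Q the default value 0 is not used. *)
Definition sqrtmx (n : nat) (Q : 'M[F]_n) : 'M[F]_n :=
  xget 0 [set S | psdmx S /\ S *m S = Q].

Definition controllable (n m : nat) (A : 'M[F]_n) (B : 'M[F]_(n, m)) : Prop :=
  \rank (\mxrow_(k < n) (A ^+ k *m B)) = n.

(* Stability is in the discrete-time sense: all the complex eigenvalues lie in
   the open unit disc. *)
Definition stablemx_dt (n : nat) (A : 'M[F]_n) : Prop :=
  forall z : F[i], eigenvalue (map_mx (real_complex F) A) z -> `|z| < 1.

Definition detectable (n p : nat) (A : 'M[F]_n) (C : 'M[F]_(p, n)) : Prop :=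
  exists K : 'M[F]_(n, p), stablemx_dt (A + K *m C).

End Matrices.

Section LossyFiltering.
Variables (F : realType) (n p : nat).
Variables (A : 'M[F]_n) (C : 'M[F]_(p, n)) (Q : 'M[F]_n) (R : 'M[F]_p).

Definition riccati (q : F) (X : 'M[F]_n) : 'M[F]_n :=
  A *m X *m A^T + Q
  - q *: (A *m X *m C^T *m invmx (C *m X *m C^T + R) *m C *m X *m A^T).

Definition psd_fixpoint (q : F) (X : 'M[F]_n) : Prop :=
  psdmx X /\ X = riccati q X.

(* At most one number satisfies this predicate. *)
Definition is_critical_value (qc : F) : Prop :=
  0 <= qc < 1 /\
  forall q : F, 0 < q <= 1 -> ((exists X, psd_fixpoint q X) <-> qc < q).

(* X(q); above the critical value the fixed point exists and is unique. *)
Definition fixpoint_of (q : F) : 'M[F]_n := xget 0 [set X | psd_fixpoint q X].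

Definition Gamma (q : F) (G : 'M[F]_n) (H : 'M[F]_(n, p)) :
    'M[F]_(n + (n + (n + (p + n)))) :=
  let L := row_mx (Num.sqrt (1 - q) *: (G *m A))
          (row_mx (Num.sqrt q *: (G *m A + H *m C))
          (row_mx (Num.sqrt q *: H) G)) in
  block_mx G   L
           L^T (block_mx G 0 0
               (block_mx G 0 0
               (block_mx (invmx R) 0 0 (invmx Q)))).

Variables (qc gamma : F).

Definition trace_feasible : set F :=
  [set q | qc < q <= 1 /\ \tr (fixpoint_of q) <= gamma].

Definition lmi_constraints
    (q : F) (G : 'M[F]_n) (H : 'M[F]_(n, p)) (Y : 'M[F]_n) : Prop :=
  [/\ pdmx G /\ pdmx Y,
      \tr Y <= gamma,
      psdmx (block_mx Y 1%:M 1%:M G),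
      pdmx (Gamma q G H)
    & qc < q <= 1].

Definition lmi_feasible : set F :=
  [set q | exists G H Y, lmi_constraints q G H Y].

(* For fixed q the constraints are convex in (G, H, Y), and the objective
   minimised over q and H is a quasi-convex function of (G, Y): its sublevel
   sets are convex. Joint convexity of the constraints in (q, G, H, Y) fails
   already for n = p = 1. *)
Definition lmi_quasi_convex : Prop :=
  (forall q : F, convex_set
     [set z : 'M[F]_n * 'M[F]_(n, p) * 'M[F]_n
       | lmi_constraints q z.1.1 z.1.2 z.2]) /\
  (forall t : F, convex_set
     [set z : 'M[F]_n * 'M[F]_n
       | exists q H, q <= t /\ lmi_constraints q z.1 H z.2]).

End LossyFiltering.

Section Minimisation.
Variable F : realType.

(* An infeasible problem is given the value 1. *)
Definition is_solution (S : set F) (q : F) : Prop :=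
  (S q /\ lbound S q) \/ (S = set0 /\ q = 1).

(* Unlike is_solution, the minimum need not be attained: the feasible sets
   here are cut out by strict inequalities. *)
Definition optimal_value (S : set F) : F :=
  if `[< S !=set0 >] then inf S else 1.

End Minimisation.

(* Main.v *)
Require Import Defs.
From HB Require Import structures.
From mathcomp Require Import all_boot all_order all_algebra.
From mathcomp Require Import boolp classical_sets reals convex.
From mathcomp Require Import complex.
From mathcomp Require Import interval_inference ring lra.

Set Implicit Arguments.
Unset Strict Implicit.
Unset Printing Implicit Defensive.

Import Order.TTheory GRing.Theory Num.Theory.

Local Open Scope classical_set_scope.
Local Open Scope ring_scope.

(** Write [g_q] for [riccati q]. Two facts about it drive everything.

    First, for a fixed gain [K] the Joseph form
      phi_q(K,X) = (1-q) A X A' + q (A+KC) X (A+KC)' + q K R K' + Q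
    is affine and monotone in [X], and completing the square in [K] shows that
    [g_q(X)] is the minimum of [phi_q(K,X)] over [K] in the Loewner order
    ([joseph_square]). So [g_q] is monotone and concave, with a margin given by
    [Q > 0] ([riccati_shrink], [riccati_inflate_lt]).

    Second, with [X = G^-1] and [H = G K], the Schur complement of the
    block-diagonal part of [Gamma_q(G,H)] is [G (X - phi_q(K,X)) G]
    ([Gamma_pdP]). Hence some [H] makes [Gamma_q(G,H)] positive definite if and
    only if [g_q(X) < X], and likewise the small matrix inequality says
    [X <= Y].

    Concavity and monotonicity give a comparison principle: a fixed point lies
    below every [X >= 0] with [g_q(X) <= X] ([fixpoint_le]). Therefore the fixed
    point [X(q)] is unique and decreases with [q], and the matrix inequalities
    force [X(q) < X <= Y]. Conversely, if [Tr X(q) < gamma], inflating [X(q)] by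
    a factor slightly above [1] gives a strict solution. The values of [q]
    admitted by the matrix inequalities are thus exactly those with
    [Tr X(q) < gamma] ([lmi_feasibleP]), and the two problems differ only by the
    strictness of this bound.

    This difference can matter only if [Tr X(q)] is constantly [gamma], because
    [Tr X(q)] is either strictly decreasing or constant: if [X(q1) = X(q2)] with
    [q1 < q2], the correction term of the Riccati map vanishes there, and the
    same matrix is the fixed point for every [q] ([fixpoint_of_const]). The
    constant value [gamma] is excluded on both sides of the theorem: the trace
    problem would be feasible on the whole interval above [qc] and have no
    minimum, and the matrix inequalities would have no solution.

    Quasi-convexity: at fixed [q] the constraints are affine in [(G,H,Y)], and
    [g_q(X)] decreases with [q], so two points of a sublevel set can be brought
    to the larger of their two values of [q] before they are averaged. *)

Local Notation quad M x := ((x^T *m M *m x) 0 0).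
Local Notation "M <=L N" := (psdmx (N - M)) (at level 70, no associativity).
Local Notation "M <L N" := (pdmx (N - M)) (at level 70, no associativity).

(** * Quadratic forms and the Loewner order *)

Section QuadraticForms.
Variable F : realType.

Lemma quadD n (M N : 'M[F]_n) (x : 'cV_n) :
  quad (M + N) x = quad M x + quad N x.
Proof. by rewrite mulmxDr mulmxDl mxE. Qed.

Lemma quadZ n a (M : 'M[F]_n) (x : 'cV_n) : quad (a *: M) x = a * quad M x.
Proof. by rewrite -scalemxAr -scalemxAl mxE. Qed.

Lemma quad_congr m n (B : 'M[F]_(m, n)) (M : 'M_n) (x : 'cV_m) :
  quad (B *m M *m B^T) x = quad M (B^T *m x).
Proof. by rewrite trmx_mul trmxK !mulmxA. Qed.

Lemma trmx_congr m n (B : 'M[F]_(m, n)) (M : 'M_n) :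
  M^T = M -> (B *m M *m B^T)^T = B *m M *m B^T.
Proof. by move=> MT; rewrite !trmx_mul trmxK MT mulmxA. Qed.

Lemma psdmx0 n : psdmx (0 : 'M[F]_n).
Proof. by split=> [|x]; rewrite ?trmx0// mulmx0 mul0mx mxE. Qed.

Lemma psdmxD n (M N : 'M[F]_n) : psdmx M -> psdmx N -> psdmx (M + N).
Proof.
move=> [MT M0] [NT N0]; split; first by rewrite linearD/= MT NT.
by move=> x; rewrite quadD addr_ge0.
Qed.

Lemma psdmxZ n a (M : 'M[F]_n) : 0 <= a -> psdmx M -> psdmx (a *: M).
Proof.
move=> a0 [MT M0]; split; first by rewrite linearZ/= MT.
by move=> x; rewrite quadZ mulr_ge0.
Qed.

Lemma psdmx_congr m n (B : 'M[F]_(m, n)) (M : 'M_n) :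
  psdmx M -> psdmx (B *m M *m B^T).
Proof.
by move=> [MT M0]; split=> [|x]; rewrite ?trmx_congr// quad_congr.
Qed.

Lemma pdmxW n (M : 'M[F]_n) : pdmx M -> psdmx M.
Proof.
move=> [MT M0]; split=> // x; have [->|/M0/ltW//] := eqVneq x 0.
by rewrite mulmx0 mxE.
Qed.

Lemma pdmxD n (M N : 'M[F]_n) : pdmx M -> psdmx N -> pdmx (M + N).
Proof.
move=> [MT M0] [NT N0]; split; first by rewrite linearD/= MT NT.
by move=> x x0; rewrite quadD ltr_wpDr ?M0.
Qed.

Lemma pdmxZ n a (M : 'M[F]_n) : 0 < a -> pdmx M -> pdmx (a *: M).
Proof.
move=> a0 [MT M0]; split; first by rewrite linearZ/= MT.
by move=> x x0; rewrite quadZ mulr_gt0 ?M0.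
Qed.

Lemma pdmx_conv n t (M N : 'M[F]_n) : 0 <= t <= 1 ->
  pdmx M -> pdmx N -> pdmx (t *: M + (1 - t) *: N).
Proof.
move=> /andP[t0 t1] M0 N0; move: t0; rewrite le_eqVlt => /predU1P[<-|t0].
  by rewrite scale0r add0r subr0 scale1r.
apply: pdmxD; first exact: pdmxZ.
by apply: psdmxZ; rewrite ?subr_ge0//; exact: pdmxW.
Qed.

Lemma pdmx_unit n (M : 'M[F]_n) : pdmx M -> M \in unitmx.
Proof.
move=> [_ M0]; rewrite -row_free_unit -kermx_eq0; apply: contraT.
move=> /rowV0Pn[v /sub_kermxP vM v0].
have /M0 : v^T != 0 by rewrite trmx_eq0.
by rewrite trmxK vM mul0mx mxE ltxx.
Qed.

Lemma pdmx_congr n (B : 'M[F]_n) (M : 'M_n) :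
  B \in unitmx -> pdmx M -> pdmx (B *m M *m B^T).
Proof.
move=> Bu [MT M0]; split=> [|x x0]; rewrite ?trmx_congr// quad_congr M0//.
apply: contra_neq x0 => BTx.
by rewrite -[x](mulKmx (_ : B^T \in unitmx)) ?unitmx_tr// BTx mulmx0.
Qed.

Lemma invmx_sym n (M : 'M[F]_n) : M^T = M -> (invmx M)^T = invmx M.
Proof. by move=> MT; rewrite trmx_inv MT. Qed.

Lemma pdmx_inv n (M : 'M[F]_n) : pdmx M -> pdmx (invmx M).
Proof.
move=> M0; have Mu := pdmx_unit M0.
have := pdmx_congr (_ : invmx M \in unitmx) M0.
rewrite unitmx_inv => /(_ Mu); rewrite invmx_sym ?(M0.1)//.
by rewrite mulVmx// mul1mx.
Qed.

Lemma lemx_trans n (N M P : 'M[F]_n) : M <=L N -> N <=L P -> M <=L P.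
Proof. by move=> MN NP; have := psdmxD NP MN; rewrite addrA subrK. Qed.

Lemma lemx_ltmx_trans n (N M P : 'M[F]_n) : M <=L N -> N <L P -> M <L P.
Proof. by move=> MN NP; have := pdmxD NP MN; rewrite addrA subrK. Qed.

Lemma quad_diag n (M : 'M[F]_n) i : quad M (delta_mx i 0 : 'cV_n) = M i i.
Proof. by rewrite trmx_delta -rowE -colE !mxE. Qed.

Lemma mxtrace_psdmx_ge0 n (M : 'M[F]_n) : psdmx M -> 0 <= \tr M.
Proof.
by move=> [_ M0]; apply: sumr_ge0 => i _; rewrite -quad_diag M0.
Qed.

Lemma lemx_mxtrace n (M N : 'M[F]_n) : M <=L N -> \tr M <= \tr N.
Proof. by move=> /mxtrace_psdmx_ge0; rewrite linearB/= subr_ge0. Qed.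

Lemma mxtrace_pdmx_gt0 n (M : 'M[F]_n) : (0 < n)%N -> pdmx M -> 0 < \tr M.
Proof.
move=> n0 M0; rewrite /mxtrace (bigD1 (Ordinal n0))//= ltr_wpDr//.
  by apply: sumr_ge0 => i _; rewrite -quad_diag (pdmxW M0).2.
rewrite -quad_diag M0.2//; apply/eqP => /matrixP/(_ (Ordinal n0) 0)/eqP.
by rewrite !mxE !eqxx oner_eq0.
Qed.

(** The diagonal entries are nonnegative with sum zero, and the form on
    [e_i + e_j] and [e_i - e_j] then fixes the sign of [M i j] both ways. *)
Lemma psdmx_mxtrace_eq0 n (M : 'M[F]_n) : psdmx M -> \tr M = 0 -> M = 0.
Proof.
move=> [MT M0] trM.
have Md i : M i i = 0.
  have /eqP := trM; rewrite /mxtrace psumr_eq0; last first.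
    by move=> j _; rewrite -quad_diag M0.
  by move=> /allP/(_ i)/[!mem_index_enum]/(_ isT)/eqP.
pose e i : 'cV[F]_n := delta_mx i 0.
have E s i j : quad M (e i + s *: e j) = s * (M i j *+ 2).
  rewrite [(_ + _)^T]linearD/= [(_ *: _)^T]linearZ/= !trmx_delta mulmxDl.
  rewrite mulmxDr mulmxDl -!scalemxAl mulmxDl -!scalemxAr -!scalemxAl.
  rewrite -!rowE -!colE !mxE !Md.
  have -> : M j i = M i j by rewrite -[in LHS]MT mxE.
  by ring.
apply/matrixP => i j; rewrite mxE; apply/eqP; rewrite eq_le.
have := M0 (e i + -1 *: e j).
have := M0 (e i + 1 *: e j).
by rewrite !E; lra.
Qed.

Lemma lemx_anti_mxtrace n (M N : 'M[F]_n) : M <=L N -> \tr M = \tr N -> M = N.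
Proof.
move=> MN tMN; apply/esym/eqP; rewrite -subr_eq0; apply/eqP.
by apply: psdmx_mxtrace_eq0 => //; rewrite linearB/= tMN subrr.
Qed.

(** Cauchy-Schwarz for the inner product of [M], between [x] and
    [M^-1 e_i]: the form is nonnegative on [x - t M^-1 e_i] for every [t]. *)
Lemma sqr_coord_le n (M : 'M[F]_n) (x : 'cV_n) i : pdmx M ->
  x i 0 ^+ 2 <= invmx M i i * quad M x.
Proof.
move=> M0; have Mu := pdmx_unit M0; have V0 := pdmx_inv M0.
have c0 : 0 < invmx M i i.
  rewrite -quad_diag V0.2//; apply/eqP => /matrixP/(_ i 0)/eqP.
  by rewrite !mxE !eqxx oner_eq0.
have E t : quad M (x - t *: (invmx M *m delta_mx i 0)) =
    quad M x - t * x i 0 *+ 2 + t ^+ 2 * invmx M i i.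
  rewrite [(_ - _)^T]linearB/= [(_ *: _)^T]linearZ/= trmx_mul V0.1 trmx_delta.
  rewrite mulmxBl mulmxBr !mulmxBl -!scalemxAr -!scalemxAl.
  rewrite !mulmxA -[_ *m invmx M *m M]mulmxA mulVmx// mulmx1.
  rewrite -[_ *m M *m invmx M]mulmxA mulmxV// mulmx1.
  by rewrite -!rowE -!colE !mxE; ring.
have := (pdmxW M0).2 (x - (x i 0 / invmx M i i) *: (invmx M *m delta_mx i 0)).
rewrite E -(pmulr_rge0 _ c0) => H; rewrite -subr_ge0.
suff <- : invmx M i i * (quad M x - x i 0 / invmx M i i * x i 0 *+ 2 +
  (x i 0 / invmx M i i) ^+ 2 * invmx M i i) =
  invmx M i i * quad M x - x i 0 ^+ 2 by [].
by field; rewrite gt_eqF.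
Qed.

(** [sqr_coord_le] bounds every coordinate of [x] by [quad M x], which serves as
    a lower bound on the least eigenvalue of [M]. *)
Lemma pdmx_dominates n (M N : 'M[F]_n) : pdmx M -> N^T = N ->
  exists2 e, 0 < e < 1 & e *: N <=L M.
Proof.
move=> M0 NT; have V0 := pdmx_inv M0.
have c0 i : 0 <= invmx M i i by rewrite -quad_diag (pdmxW V0).2.
pose S := \sum_j \sum_i `|N i j| * (invmx M i i + invmx M j j).
have S0 : 0 <= S.
  by do 2!(apply: sumr_ge0 => ? _); rewrite mulr_ge0// addr_ge0.
have NS (x : 'cV_n) : quad N x <= S * quad M x.
  rewrite mxE mulr_suml; apply: ler_sum => j _.
  rewrite mxE !mulr_suml; apply: ler_sum => i _; rewrite mxE.
  have Hi := sqr_coord_le x i M0; have Hj := sqr_coord_le x j M0.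
  rewrite -[leRHS]mulrA mulrDl.
  apply: le_trans (_ : `|N i j| * (x i 0 ^+ 2 + x j 0 ^+ 2) <= _); last first.
    by rewrite ler_wpM2l// lerD.
  apply: le_trans (ler_norm _) _.
  rewrite [_ * N i j]mulrC -mulrA normrM ler_wpM2l//.
  rewrite normrM -[x i 0 ^+ 2]real_normK ?num_real//.
  rewrite -[x j 0 ^+ 2]real_normK ?num_real//.
  have := sqr_ge0 (`|x i 0| - `|x j 0|).
  by have := normr_ge0 (x i 0); have := normr_ge0 (x j 0); nra.
have S1 : 1 < 2 + S by rewrite ltr_wpDr// ltr1n.
have S2 := lt_trans ltr01 S1.
(* [S^-1] would do for the order, but [S] may vanish; adding [2] also gives
   [e < 1]. *)
exists (2 + S)^-1; first by rewrite invr_gt0 S2 invf_lt1.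
split; first by rewrite linearB linearZ/= NT M0.1.
move=> x; rewrite -scaleN1r !(quadD, quadZ) mulN1r subr_ge0 mulrC ler_pdivrMr//.
rewrite mulrC (le_trans (NS x))// ler_wpM2r ?lerDr// (pdmxW M0).2//.
Qed.

End QuadraticForms.

(** * Schur complements *)

Section SchurComplement.
Variable F : realType.

(** Completing the square in the second block of variables. *)
Lemma quad_block m n (M : 'M[F]_m) (L : 'M_(m, n)) (D E : 'M_n)
    (x : 'cV_m) (y : 'cV_n) : E^T = E -> D *m E = 1%:M ->
  quad (block_mx M L L^T D) (col_mx x y) =
  quad (M - L *m E *m L^T) x + quad D (y + E *m L^T *m x).
Proof.
move=> ET DE; have ED := mulmx1C DE.
suff -> : (col_mx x y)^T *m block_mx M L L^T D *m col_mx x y =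
  x^T *m (M - L *m E *m L^T) *m x +
  (y + E *m L^T *m x)^T *m D *m (y + E *m L^T *m x) by rewrite mxE.
rewrite tr_col_mx mul_row_block mul_row_col mulmxBr [(_ + _)^T]linearD/=.
rewrite !trmx_mul trmxK.
rewrite ET !mulmxDl !mulmxDr mulNmx !mulmxA.
rewrite -[_ *m D *m E]mulmxA DE mulmx1 -[_ *m E *m D]mulmxA ED mulmx1.
move: (x^T *m M *m x) (y^T *m L^T *m x) (x^T *m L *m y) (y^T *m D *m y).
move: (_ *m E *m _ *m _) => a b c d e.
by apply/matrixP => i j; rewrite !mxE; ring.
Qed.

Lemma schur_psdmx m n (M : 'M[F]_m) (L : 'M_(m, n)) (D : 'M_n) : pdmx D ->
  psdmx (block_mx M L L^T D) <-> psdmx (M - L *m invmx D *m L^T).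
Proof.
move=> D0; have Du := pdmx_unit D0; have VT := invmx_sym D0.1.
have LT := trmx_congr L VT.
split=> -[MT M0]; split.
- move: MT; rewrite tr_block_mx => /eq_block_mx[MT _ _ _].
  by rewrite linearB/= LT MT.
- move=> x; have := M0 (col_mx x (- (invmx D *m L^T *m x))).
  rewrite (quad_block _ _ _ _ VT) ?mulmxV// addNr mulmx0 [X in _ + X]mxE.
  by rewrite addr0.
- move: MT; rewrite linearB/= LT => /addIr MT.
  by rewrite tr_block_mx MT trmxK D0.1.
- move=> z; rewrite -[z]vsubmxK (quad_block _ _ _ _ VT) ?mulmxV//.
  by rewrite addr_ge0// (pdmxW D0).2.
Qed.

Lemma schur_pdmx m n (M : 'M[F]_m) (L : 'M_(m, n)) (D : 'M_n) : pdmx D ->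
  pdmx (block_mx M L L^T D) <-> pdmx (M - L *m invmx D *m L^T).
Proof.
move=> D0; have Du := pdmx_unit D0; have VT := invmx_sym D0.1.
have LT := trmx_congr L VT.
split=> -[MT M0]; split.
- move: MT; rewrite tr_block_mx => /eq_block_mx[MT _ _ _].
  by rewrite linearB/= LT MT.
- move=> x x0; have := M0 (col_mx x (- (invmx D *m L^T *m x))).
  rewrite (quad_block _ _ _ _ VT) ?mulmxV// addNr mulmx0 [X in _ + X]mxE.
  by rewrite addr0 col_mx_eq0 negb_and x0; exact.
- move: MT; rewrite linearB/= LT => /addIr MT.
  by rewrite tr_block_mx MT trmxK D0.1.
- move=> z; rewrite -[z]vsubmxK (quad_block _ _ _ _ VT) ?mulmxV//.
  move: (usubmx z) (dsubmx z) => x y.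
  have [->|x0 _] := eqVneq x 0.
    rewrite col_mx_eq0 eqxx/= => y0.
    by rewrite !mulmx0 addr0 mxE add0r D0.2.
  by rewrite ltr_wpDr ?M0// (pdmxW D0).2.
Qed.

Lemma pdmx_block_diag m n (M : 'M[F]_m) (D : 'M_n) :
  pdmx M -> pdmx D -> pdmx (block_mx M 0 0 D).
Proof.
move=> M0 D0; have := @schur_pdmx _ _ M 0 D D0.
by rewrite trmx0 mulmx0 subr0 => ->.
Qed.

Lemma row_mx_block_diag m k l (a : 'M[F]_(m, k)) (b : 'M[F]_(m, l)) M D :
  row_mx a b *m block_mx M 0 0 D *m (row_mx a b)^T =
  a *m M *m a^T + b *m D *m b^T.
Proof.
by rewrite tr_row_mx mul_row_block mul_row_col !mulmx0 addr0 add0r.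
Qed.

Lemma invmx_pd_block_diag m k (M : 'M[F]_m) (D : 'M_k) : pdmx M -> pdmx D ->
  invmx (block_mx M 0 0 D) = block_mx (invmx M) 0 0 (invmx D).
Proof.
by move=> M0 D0; rewrite invmx_block_diag//; exact/pdmx_unit/pdmx_block_diag.
Qed.

End SchurComplement.

(** * The Riccati map *)

Section Riccati.
Context {F : realType} {n p : nat}.
Context {A : 'M[F]_n} {C : 'M[F]_(p, n)} {Q : 'M[F]_n} {R : 'M[F]_p}.
Context (Q_pd : pdmx Q) (R_pd : pdmx R).
Implicit Types (X Z G Y : 'M[F]_n) (K H : 'M[F]_(n, p)) (q t : F).

Local Notation riccati := (riccati A C Q R).
Local Notation psd_fixpoint := (psd_fixpoint A C Q R).

Definition innovation_cov X : 'M[F]_p := C *m X *m C^T + R.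

(** The Kalman gain, with the sign that makes [A + K C] the closed-loop
    matrix. *)
Definition opt_gain X : 'M[F]_(n, p) :=
  - (A *m X *m C^T *m invmx (innovation_cov X)).

(** The Joseph form [joseph] is split into its part that is linear in [X] and
    its constant part: linearity of the first gives the monotonicity of the
    Riccati map, and positivity of the second gives its strict concavity along
    rays. *)
Definition gain_noise q K : 'M[F]_n := q *: (K *m R *m K^T) + Q.

Definition gain_lin q K X : 'M[F]_n :=
  (1 - q) *: (A *m X *m A^T) + q *: ((A + K *m C) *m X *m (A + K *m C)^T).

Definition joseph q K X : 'M[F]_n := gain_lin q K X + gain_noise q K.

Lemma innovation_cov_pd X : psdmx X -> pdmx (innovation_cov X).
Proof.
move=> X0; rewrite /innovation_cov addrC; apply: pdmxD => //.
exact: psdmx_congr.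
Qed.

Lemma gain_noise_pd q K : 0 <= q -> pdmx (gain_noise q K).
Proof.
move=> q0; rewrite /gain_noise addrC; apply: pdmxD => //.
by apply: psdmxZ => //; exact/psdmx_congr/pdmxW.
Qed.

Lemma gain_lin_psd q K X : 0 <= q <= 1 -> psdmx X -> psdmx (gain_lin q K X).
Proof.
move=> /andP[q0 q1] X0.
by apply: psdmxD; apply: psdmxZ; rewrite ?subr_ge0//; exact: psdmx_congr.
Qed.

Lemma gain_linB q K X Z :
  gain_lin q K (X - Z) = gain_lin q K X - gain_lin q K Z.
Proof.
rewrite /gain_lin !(mulmxBr, mulmxBl) !scalerBr.
by rewrite opprD addrACA.
Qed.

Lemma gain_linZ q K t X : gain_lin q K (t *: X) = t *: gain_lin q K X.
Proof.
rewrite /gain_lin -!scalemxAr -!scalemxAl scalerDr !scalerA.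
by rewrite ![t * _]mulrC.
Qed.

(** Completing the square in the gain: the Riccati map is the lower envelope
    of the Joseph forms. *)
Lemma joseph_square q K X : psdmx X ->
  joseph q K X = riccati q X +
    q *: ((K - opt_gain X) *m innovation_cov X *m (K - opt_gain X)^T).
Proof.
move=> X0; have S0 := innovation_cov_pd X0; have Su := pdmx_unit S0.
rewrite /joseph /gain_lin /gain_noise /Defs.riccati /opt_gain.
rewrite -/(innovation_cov X).
rewrite opprK.
have -> : (A + K *m C) *m X *m (A + K *m C)^T = A *m X *m A^T +
    A *m X *m C^T *m K^T + K *m C *m X *m A^T +
    K *m (innovation_cov X - R) *m K^T.
  rewrite /innovation_cov addrK [(A + _)^T]linearD/= !trmx_mul.
  by rewrite !(mulmxDl, mulmxDr) !mulmxA !addrA [X in X + _]addrAC.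
move: (innovation_cov X) S0 Su => S S0 Su.
have -> : (K + A *m X *m C^T *m invmx S) *m S *m
    (K + A *m X *m C^T *m invmx S)^T = K *m S *m K^T + K *m C *m X *m A^T +
    A *m X *m C^T *m K^T + A *m X *m C^T *m invmx S *m C *m X *m A^T.
  rewrite [(K + _)^T]linearD/= !trmx_mul trmxK (invmx_sym S0.1) X0.1.
  rewrite !(mulmxDl, mulmxDr) !mulmxA.
  rewrite -[_ *m invmx S *m S]mulmxA mulVmx// mulmx1.
  rewrite -[_ *m S *m invmx S]mulmxA mulmxV// mulmx1 !addrA.
  by rewrite [X in X + _]addrAC.
rewrite mulmxBr mulmxBl.
move: (A *m X *m A^T) (A *m X *m C^T *m K^T) (K *m C *m X *m A^T).
move: (K *m S *m K^T).
move: (K *m R *m K^T) (_ *m invmx S *m _ *m _ *m _) => a b c d e f.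
by apply/matrixP => i j; rewrite !mxE; ring.
Qed.

Lemma riccati_le_joseph q K X : 0 <= q -> psdmx X ->
  riccati q X <=L joseph q K X.
Proof.
move=> q0 X0; rewrite joseph_square// addrAC subrr add0r; apply: psdmxZ => //.
exact/psdmx_congr/pdmxW/innovation_cov_pd.
Qed.

Lemma joseph_opt_gain q X : psdmx X -> joseph q (opt_gain X) X = riccati q X.
Proof. by move=> X0; rewrite joseph_square// subrr !mul0mx scaler0 addr0. Qed.

(** A lower envelope of monotone maps is monotone. *)
Lemma riccati_homo q X Z : 0 <= q <= 1 -> psdmx Z -> psdmx X ->
  Z <=L X -> riccati q Z <=L riccati q X.
Proof.
move=> q01 Z0 X0 ZX; have /andP[q0 _] := q01.
rewrite -(joseph_opt_gain q X0).
apply: (lemx_trans (riccati_le_joseph (opt_gain X) q0 Z0)).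
rewrite /joseph opprD addrACA subrr addr0 -gain_linB.
exact: gain_lin_psd.
Qed.

(** Concavity of the Riccati map on the segment from [0] to [X], where
    [riccati q 0 = Q]. *)
Lemma riccati_shrink q t X : 0 <= q <= 1 -> 0 <= t <= 1 -> psdmx X ->
  t *: riccati q X + (1 - t) *: Q <=L riccati q (t *: X).
Proof.
move=> /andP[q0 q1] /andP[t0 t1] X0; have tX0 := psdmxZ t0 X0.
rewrite -(joseph_opt_gain q tX0); set K := opt_gain _.
have -> : joseph q K (t *: X) - (t *: riccati q X + (1 - t) *: Q) =
    t *: (joseph q K X - riccati q X) + (1 - t) *: (q *: (K *m R *m K^T)).
  rewrite /joseph /gain_noise gain_linZ.
  move: (gain_lin _ _ _) (riccati _ _) (K *m R *m K^T) => a b c.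
  by apply/matrixP => i j; rewrite !mxE; ring.
apply: psdmxD; first by apply: psdmxZ => //; exact: riccati_le_joseph.
by do 2!(apply: psdmxZ; rewrite ?subr_ge0//); exact/psdmx_congr/pdmxW.
Qed.

(** Concavity again, read beyond [X]: a fixed point becomes a strict
    supersolution when it is scaled up, with margin at least [(t - 1) Q]. *)
Lemma riccati_inflate_lt q t X : 0 <= q -> 1 < t -> psdmx X ->
  X = riccati q X -> riccati q (t *: X) <L t *: X.
Proof.
move=> q0 t1 X0 Xfix; have t0 : 0 <= t by rewrite ltW// (lt_trans ltr01).
have tX0 := psdmxZ t0 X0.
apply: (lemx_ltmx_trans (riccati_le_joseph (opt_gain X) q0 tX0)).
rewrite {1}Xfix -(joseph_opt_gain q X0) /joseph gain_linZ scalerDr.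
rewrite opprD addrACA subrr add0r -[X in _ - X]scale1r -scalerBl.
by apply: pdmxZ; rewrite ?subr_gt0//; exact: gain_noise_pd.
Qed.

Lemma riccati_ge_noise q X : 0 <= q <= 1 -> psdmx X -> Q <=L riccati q X.
Proof.
move=> q01 X0; have /andP[q0 _] := q01.
rewrite -(joseph_opt_gain q X0) /joseph /gain_noise addrA addrK.
apply: psdmxD; first exact: gain_lin_psd.
by apply: psdmxZ => //; exact/psdmx_congr/pdmxW.
Qed.

Lemma fixpoint_pd q X : 0 <= q <= 1 -> psd_fixpoint q X -> pdmx X.
Proof.
move=> q01 [X0 Xfix]; have := pdmxD Q_pd (riccati_ge_noise q01 X0).
by rewrite addrC subrK -Xfix.
Qed.

(** Only the term subtracted in the Riccati map depends on [q], and it is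
    positive semidefinite. *)
Lemma riccati_anti q1 q2 X : q1 <= q2 -> psdmx X ->
  riccati q2 X <=L riccati q1 X.
Proof.
move=> q12 X0; have V0 := pdmx_inv (innovation_cov_pd X0).
rewrite /Defs.riccati -/(innovation_cov X) opprD addrACA subrr add0r opprK.
rewrite addrC -scalerBl; apply: psdmxZ; first by rewrite subr_ge0.
have := psdmx_congr (A *m X *m C^T) (pdmxW V0).
by rewrite !trmx_mul trmxK X0.1 !mulmxA.
Qed.

(** Comparison principle. If [t Z <= X] with [0 <= t <= 1], then
    [X >= g(X) >= g(t Z) >= t Z + (1 - t) Q >= (t + (1 - t) e) Z], where
    [e Z <= Q]. Hence the set of such [t] has supremum at least [1], and
    [t Z <= X] passes to the supremum. *)
Lemma fixpoint_le q X Z : 0 <= q <= 1 -> psd_fixpoint q Z -> psdmx X ->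
  riccati q X <=L X -> Z <=L X.
Proof.
move=> q01 [Z0 Zfix] X0 gX.
have [e /andP[e0 e1] eZ] := pdmx_dominates Q_pd Z0.1.
pose T := [set t : F | 0 <= t <= 1 /\ t *: Z <=L X].
have T0 : T 0 by split; rewrite ?lexx ?ler01// scale0r subr0.
have step t : T t -> T (t + (1 - t) * e).
  move=> [t01 tZ]; have /andP[t0 t1] := t01.
  split; first by nra.
  apply: lemx_trans gX.
  apply: (lemx_trans _ (riccati_homo q01 (psdmxZ t0 Z0) X0 tZ)).
  apply: (lemx_trans _ (riccati_shrink q01 t01 Z0)).
  rewrite -Zfix [X in _ - X]scalerDl opprD addrACA subrr add0r -scalerA.
  rewrite -scalerBr.
  by apply: psdmxZ => //; rewrite subr_ge0.
have Tub : has_ubound T by exists 1 => t [/andP[]].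
have supT t : T t -> t <= sup T by move=> /(ub_le_sup Tub).
have sup1 : 1 <= sup T.
  have : (1 - e) * sup T <= sup T - e.
    rewrite mulrC -ler_pdivlMr ?subr_gt0//; apply: ge_sup; first by exists 0.
    by move=> t /step/supT H; rewrite ler_pdivlMr ?subr_gt0//; lra.
  by rewrite mulrBl mul1r lerD2l lerN2 ler_pMr.
split; first by rewrite linearB/= X0.1 Z0.1.
move=> x; rewrite -scaleN1r quadD quadZ mulN1r subr_ge0 leNgt; apply/negP => XZ.
have Xx : 0 <= quad X x by exact: X0.2.
have Zx := le_lt_trans Xx XZ.
suff : sup T <= quad X x / quad Z x.
  move=> /(le_trans sup1); rewrite ler_pdivlMr// mul1r => /(lt_le_trans XZ).
  by rewrite ltxx.
apply: ge_sup; first by exists 0.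
move=> t [_ [_ /(_ x)]]; rewrite -scaleN1r scalerA quadD quadZ mulN1r mulNr.
by rewrite subr_ge0 ler_pdivlMr.
Qed.

End Riccati.

(** * The matrix inequalities as a Riccati inequality *)

Section LinearMatrixInequality.
Context {F : realType} {n p : nat}.
Context {A : 'M[F]_n} {C : 'M[F]_(p, n)} {Q : 'M[F]_n} {R : 'M[F]_p}.
Context (Q_pd : pdmx Q) (R_pd : pdmx R).
Implicit Types (X Z G Y : 'M[F]_n) (K H : 'M[F]_(n, p)) (q t : F).

Local Notation riccati := (riccati A C Q R).
Local Notation joseph := (@joseph F n p A C Q R).
Local Notation Gamma := (Gamma A C Q R).

(** The Schur complement of the last four diagonal blocks of [Gamma] is
    [G - G J G], for [J] the Joseph form at [G^-1]; it is congruent to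
    [G^-1 - J]. The substitution [H = G K] linearizes the gain. *)
Lemma Gamma_pdP q G K : 0 <= q <= 1 -> pdmx G ->
  pdmx (Gamma q G (G *m K)) <-> joseph q K (invmx G) <L invmx G.
Proof.
move=> /andP[q0 q1] G0; have Gu := pdmx_unit G0.
have RI := pdmx_inv R_pd; have QI := pdmx_inv Q_pd.
have D1 := pdmx_block_diag RI QI; have D2 := pdmx_block_diag G0 D1.
have D3 := pdmx_block_diag G0 D2.
rewrite /Defs.Gamma; apply: (iff_trans (schur_pdmx _ _ D3)).
rewrite !invmx_pd_block_diag// !invmxK !row_mx_block_diag.
set S := (X in pdmx (G - X)).
have -> : S = G *m joseph q K (invmx G) *m G.
  rewrite /S /joseph /gain_lin /gain_noise.
  rewrite ![(_ *: _)^T]linearZ/= -!scalemxAl -!scalemxAr !scalerA.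
  rewrite -!expr2 !sqr_sqrtr ?subr_ge0// -[G *m K *m C]mulmxA -mulmxDr.
  move: (A + K *m C) => B; rewrite !trmx_mul G0.1 !mulmxDr !mulmxDl.
  by rewrite -!scalemxAr -!scalemxAl !mulmxA !addrA.
have -> : G - G *m joseph q K (invmx G) *m G =
    G *m (invmx G - joseph q K (invmx G)) *m G^T.
  by rewrite G0.1 mulmxBr mulmxBl mulmxV// mul1mx.
split; last exact: pdmx_congr.
move=> /(pdmx_congr (_ : invmx G \in unitmx)); rewrite unitmx_inv => /(_ Gu).
by rewrite (invmx_sym G0.1) G0.1 !mulmxA mulVmx// mul1mx mulmxK.
Qed.

(** Minimizing the Joseph form over the gain eliminates [H]. *)
Lemma Gamma_feasibleP q G : 0 <= q <= 1 -> pdmx G ->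
  (exists H, pdmx (Gamma q G H)) <-> riccati q (invmx G) <L invmx G.
Proof.
move=> q01 G0; have Gu := pdmx_unit G0; have I0 := pdmxW (pdmx_inv G0).
have /andP[q0 _] := q01; split=> [[H]|gG].
  rewrite -[H](mulKVmx Gu) Gamma_pdP//.
  exact/lemx_ltmx_trans/riccati_le_joseph.
exists (G *m @opt_gain _ _ _ A C R (invmx G)).
by rewrite Gamma_pdP// joseph_opt_gain.
Qed.

Lemma psdmx_block1P Y G : pdmx G ->
  psdmx (block_mx Y 1%:M 1%:M G) <-> invmx G <=L Y.
Proof.
move=> G0; have := schur_psdmx Y 1%:M G0.
by rewrite trmx1 mul1mx mulmx1.
Qed.

End LinearMatrixInequality.

(** * The two optimization problems *)

Section Optimization.
Context {F : realType} {n p : nat}.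
Context {A : 'M[F]_n} {C : 'M[F]_(p, n)} {Q : 'M[F]_n} {R : 'M[F]_p}.
Context {qc gamma : F}.
Context (Q_pd : pdmx Q) (R_pd : pdmx R).
Context (qc_crit : is_critical_value A C Q R qc).
Implicit Types (X Z G Y : 'M[F]_n) (K H : 'M[F]_(n, p)) (q t : F).

Local Notation riccati := (riccati A C Q R).
Local Notation psd_fixpoint := (psd_fixpoint A C Q R).
Local Notation fixpoint_of := (fixpoint_of A C Q R).
Local Notation lmi_constraints := (lmi_constraints A C Q R qc gamma).
Local Notation lmi_feasible := (lmi_feasible A C Q R qc gamma).
Local Notation trace_feasible := (trace_feasible A C Q R qc gamma).

Lemma supercritical01 q : qc < q <= 1 -> 0 <= q <= 1.
Proof.
have [/andP[qc0 _] _] := qc_crit.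
by move=> /andP[/ltW/(le_trans qc0) -> ->].
Qed.

Lemma fixpoint_ofP q : qc < q <= 1 -> psd_fixpoint q (fixpoint_of q).
Proof.
have [/andP[qc0 _] ex] := qc_crit.
move=> /andP[qcq q1]; apply: xgetPex; apply/ex => //.
by rewrite q1 (le_lt_trans qc0).
Qed.

Lemma fixpoint_of_le q X : qc < q <= 1 -> psdmx X -> riccati q X <=L X ->
  fixpoint_of q <=L X.
Proof.
by move=> qcq; apply: fixpoint_le (fixpoint_ofP qcq); rewrite ?supercritical01.
Qed.

Lemma fixpoint_ofE q X : qc < q <= 1 -> psd_fixpoint q X -> fixpoint_of q = X.
Proof.
move=> qcq Xfix; have [X0 Xg] := Xfix; have [Z0 Zg] := fixpoint_ofP qcq.
have q01 := supercritical01 qcq.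
have ZX : fixpoint_of q <=L X.
  by apply: fixpoint_of_le; rewrite // -Xg subrr; exact: psdmx0.
have XZ : X <=L fixpoint_of q.
  apply: (fixpoint_le Q_pd R_pd q01 Xfix Z0).
  by rewrite -Zg subrr; exact: psdmx0.
by apply: lemx_anti_mxtrace => //; apply/eqP; rewrite eq_le !lemx_mxtrace.
Qed.

Lemma fixpoint_of_anti q1 q2 : qc < q1 -> q1 <= q2 -> q2 <= 1 ->
  fixpoint_of q2 <=L fixpoint_of q1.
Proof.
move=> qc1 q12 q21.
have [X0 Xg] : psd_fixpoint q1 (fixpoint_of q1).
  by apply: fixpoint_ofP; rewrite qc1 (le_trans q12).
apply: fixpoint_of_le => //; first by rewrite q21 (lt_le_trans qc1).
by rewrite [X in X - _]Xg; exact: riccati_anti.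
Qed.

(** Subtracting the fixed-point equations at [q1] and [q2] shows that
    the correction term vanishes at the common fixed point, which then solves
    the equation for every [q]. *)
Lemma fixpoint_of_const q1 q2 q : qc < q1 -> q1 < q2 -> q2 <= 1 ->
  \tr (fixpoint_of q1) = \tr (fixpoint_of q2) -> qc < q <= 1 ->
  fixpoint_of q = fixpoint_of q1.
Proof.
move=> qc1 q12 q21 tE qcq.
have [X0 X1] : psd_fixpoint q1 (fixpoint_of q1).
  by apply: fixpoint_ofP; rewrite qc1 (le_trans (ltW q12)).
have [_ X2] : psd_fixpoint q2 (fixpoint_of q2).
  by apply: fixpoint_ofP; rewrite q21 (lt_trans qc1).
have E := lemx_anti_mxtrace (fixpoint_of_anti qc1 (ltW q12) q21) (esym tE).
rewrite E in X2; apply: fixpoint_ofE => //; split=> //.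
move: X1 X2; rewrite /Defs.riccati; set W := (X in q1 *: X) => X1 X2.
suff W0 : W = 0 by rewrite -/W W0 scaler0; move: X1; rewrite W0 scaler0.
have /addrI/oppr_inj W12 := etrans (esym X1) X2.
have /eqP : (q2 - q1) *: W = 0 by rewrite scalerBl W12 subrr.
by rewrite scaler_eq0 subr_eq0 gt_eqF//= => /eqP.
Qed.

(** From left to right, [X(q) <= G^-1] by comparison, and the strict Riccati
    inequality improves this to [X(q) = g(X(q)) <= g(G^-1) < G^-1]. From right
    to left, [G^-1 = Y] is a multiple of [X(q)]. *)
Lemma lmi_feasibleP q : 0 < gamma -> qc < q <= 1 ->
  lmi_feasible q <-> \tr (fixpoint_of q) < gamma.
Proof.
move=> gamma0 qcq; have q01 := supercritical01 qcq.
have [X0 Xg] := fixpoint_ofP qcq.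
have Xpd := fixpoint_pd Q_pd R_pd q01 (fixpoint_ofP qcq).
split=> [[G [H [Y [[G0 _] trY YG GH _]]]]|trX].
  have /(Gamma_feasibleP Q_pd R_pd q01 G0) gG :
    exists H, pdmx (Gamma A C Q R q G H) by exists H.
  move: YG => /(psdmx_block1P Y G0)/lemx_mxtrace/le_trans/(_ trY) trG.
  have I0 := pdmx_inv G0.
  have XG := fixpoint_of_le qcq (pdmxW I0) (pdmxW gG).
  have XltG : fixpoint_of q <L invmx G.
    rewrite Xg; apply: lemx_ltmx_trans gG.
    exact: riccati_homo (pdmxW I0) XG.
  (* For [n = 0] a strict inequality of matrices gives no strict inequality of
     traces; the bound is then [0 < gamma]. *)
  case: (posnP n) => [n0|n0].
    by rewrite /mxtrace big1// => i; move: (ltn_ord i); rewrite {2}n0.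
  apply: lt_le_trans trG; rewrite -subr_gt0 -linearB/=.
  exact: mxtrace_pdmx_gt0.
set T := \tr _ in trX.
have T0 : 0 <= T by exact: mxtrace_psdmx_ge0.
(* Chosen so that [(1 + s) T <= gamma]; the denominator is [1 + T] rather than
   [T] because [T = 0] when [n = 0]. *)
pose s := (gamma - T) / (1 + T).
have T1 : 0 < 1 + T by rewrite ltr_pwDl.
have s0 : 0 < s by rewrite divr_gt0// subr_gt0.
have s1 : 1 < 1 + s by rewrite ltrDl.
have sX0 : pdmx ((1 + s) *: fixpoint_of q).
  by apply: pdmxZ => //; rewrite addr_gt0.
pose G := invmx ((1 + s) *: fixpoint_of q).
have GI : invmx G = (1 + s) *: fixpoint_of q by exact: invmxK.
have G0 : pdmx G by exact: pdmx_inv.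
have [H GH] : exists H, pdmx (Gamma A C Q R q G H).
  apply/Gamma_feasibleP => //; rewrite GI.
  by apply: riccati_inflate_lt => //; case/andP: q01.
exists G, H, ((1 + s) *: fixpoint_of q).
split=> //; last first.
  by apply/psdmx_block1P => //; rewrite GI subrr; exact: psdmx0.
rewrite linearZ/= -/T mulrDl mul1r -lerBrDl /s mulrAC ler_pdivrMr//.
by rewrite ler_wpM2l ?subr_ge0 ?ltW// ltrDr.
Qed.

Lemma lmi_sub_trace q : 0 < gamma -> lmi_feasible q -> trace_feasible q.
Proof.
move=> gamma0 Lq; have [G [H [Y [_ _ _ _ qcq]]]] := Lq.
by split=> //; apply/ltW/lmi_feasibleP.
Qed.

(** This is the only way the strict and the non-strict trace bounds can
    disagree beyond a feasible [q]: [Tr X] is then [gamma] at both [q] and [q'],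
    so it is constant. *)
Lemma lmi_gap_mxtrace_const q q' :
  0 < gamma -> trace_feasible q -> q < q' <= 1 -> ~ lmi_feasible q' ->
  forall s, qc < s <= 1 -> \tr (fixpoint_of s) = gamma.
Proof.
move=> gamma0 [/andP[qcq q1] trq] /andP[qq' q'1] nL.
have qcq' : qc < q' <= 1 by rewrite q'1 (lt_trans qcq).
have trq' : gamma <= \tr (fixpoint_of q').
  by rewrite leNgt; apply/negP => H; exact/nL/lmi_feasibleP.
have le' := lemx_mxtrace (fixpoint_of_anti qcq (ltW qq') q'1).
have tE : \tr (fixpoint_of q) = gamma.
  by apply/eqP; rewrite eq_le trq (le_trans trq').
have tE' : \tr (fixpoint_of q') = gamma.
  by apply/eqP; rewrite eq_le trq' -tE le'.
move=> s qcs; rewrite (fixpoint_of_const qcq qq' q'1 _ qcs)//.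
by rewrite tE'.
Qed.

(** If the infimum over the matrix inequalities exceeded some trace-feasible
    [q], a value strictly between the two would violate the matrix inequalities,
    so the trace would be constantly [gamma] and they could not be satisfied
    at all. *)
Lemma optimal_value_lmi : 0 < gamma -> lmi_feasible !=set0 ->
  optimal_value lmi_feasible = optimal_value trace_feasible.
Proof.
move=> gamma0 L0; have LT q : lmi_feasible q -> trace_feasible q.
  exact: lmi_sub_trace.
have T0 : trace_feasible !=set0 by case: L0 => q /LT; exists q.
rewrite /optimal_value !asboolT//.
have Tlb : has_lbound trace_feasible by exists qc => q [/andP[/ltW]].
have Llb : has_lbound lmi_feasible by exists qc => q /LT[/andP[/ltW]].
apply/eqP; rewrite eq_le; apply/andP; split; last first.
  by apply: lb_le_inf => // q /LT; exact: ge_inf.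
apply: lb_le_inf => // q Tq; have [/andP[qcq q1] _] := Tq.
rewrite leNgt; apply/negP => qL.
have [r Lr] := L0; have [qcr _] := LT _ Lr; have /andP[_ r1] := qcr.
have Lr' := ge_inf Llb Lr.
pose q' := (q + inf lmi_feasible) / 2.
have nL : ~ lmi_feasible q' by move=> /(ge_inf Llb); rewrite /q'; lra.
have trE : \tr (fixpoint_of r) = gamma.
  by apply: (lmi_gap_mxtrace_const gamma0 Tq _ nL) => //; rewrite /q'; lra.
by move: Lr => /lmi_feasibleP; rewrite trE ltxx => /(_ gamma0 qcr).
Qed.

Lemma optimal_value_min (S : set F) q :
  S q -> lbound S q -> optimal_value S = q.
Proof.
move=> Sq lbq; have S0 : S !=set0 by exists q.
rewrite /optimal_value asboolT//; apply/eqP; rewrite eq_le lb_le_inf// andbT.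
by apply: ge_inf => //; exists q.
Qed.

(** When the trace problem attains its minimum below [1] the trace cannot be
    constant, since smaller values of [q] would be feasible too; so [q = 1]
    satisfies the matrix inequalities. *)
Lemma solution_lmi qopt : 0 < gamma -> is_solution trace_feasible qopt ->
  optimal_value lmi_feasible = qopt.
Proof.
move=> gamma0 sol; have [L0|L0] := pselect (lmi_feasible !=set0).
  rewrite optimal_value_lmi//; case: sol => [[]|[T0 _]].
    exact: optimal_value_min.
  by case: L0 => q /(lmi_sub_trace gamma0); rewrite T0.
rewrite /optimal_value asboolF//; case: sol => [[Tq lbq]|[_ ->]//].
have [/andP[qcq q1] _] := Tq.
apply/esym/eqP; rewrite eq_le q1 leNgt; apply/negP => qlt1.
have nL : ~ lmi_feasible 1 by move=> L1; apply: L0; exists 1.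
have trE := lmi_gap_mxtrace_const gamma0 Tq _ nL.
have /lbq : trace_feasible ((qc + qopt) / 2).
  have H : qc < (qc + qopt) / 2 <= 1 by lra.
  by split=> //; rewrite trE ?qlt1 ?lexx.
by lra.
Qed.

Lemma lmi_constraints_conv q t G1 H1 Y1 G2 H2 Y2 : 0 <= t <= 1 ->
  lmi_constraints q G1 H1 Y1 -> lmi_constraints q G2 H2 Y2 ->
  lmi_constraints q (t *: G1 + (1 - t) *: G2) (t *: H1 + (1 - t) *: H2)
    (t *: Y1 + (1 - t) *: Y2).
Proof.
move=> t01 [[G1_pd Y1_pd] tr1 YG1 GH1 qcq] [[G2_pd Y2_pd] tr2 YG2 GH2 _].
have /andP[t0 t1] := t01.
have one_conv m k (M : 'M[F]_(m, k)) : t *: M + (1 - t) *: M = M.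
  by rewrite -scalerDl addrC subrK scale1r.
split=> //; first by split; exact: pdmx_conv.
- rewrite linearD !linearZ/= -lerBrDl.
  apply: le_trans (ler_wpM2l _ tr2) _; first by rewrite subr_ge0.
  by rewrite mulrBl mul1r lerD2l lerN2 ler_wpM2l.
- have -> : block_mx (t *: Y1 + (1 - t) *: Y2) 1%:M 1%:M
      (t *: G1 + (1 - t) *: G2) =
      t *: block_mx Y1 1%:M 1%:M G1 + (1 - t) *: block_mx Y2 1%:M 1%:M G2.
    by rewrite !scale_block_mx add_block_mx !one_conv.
  by apply: psdmxD; apply: psdmxZ; rewrite ?subr_ge0.
have -> : Gamma A C Q R q (t *: G1 + (1 - t) *: G2) (t *: H1 + (1 - t) *: H2) =
    t *: Gamma A C Q R q G1 H1 + (1 - t) *: Gamma A C Q R q G2 H2.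
  rewrite /Gamma.
  set L := row_mx _ _; set L1 := row_mx _ _; set L2 := row_mx _ _.
  have -> : L = t *: L1 + (1 - t) *: L2.
    rewrite /L /L1 /L2 !scale_row_mx !add_row_mx.
    rewrite !(mulmxDl, scalerDr) -!scalemxAl !scalerA ![_ * t]mulrC.
    by rewrite ![_ * (1 - t)]mulrC [in LHS]addrACA.
  rewrite linearD !linearZ/= !scale_block_mx !add_block_mx.
  by rewrite !scaler0 !addr0 !one_conv.
exact: pdmx_conv.
Qed.

(** [G] and [Y] can be kept; only the gain has to be chosen anew, which is why
    [H] is eliminated first. *)
Lemma lmi_constraints_mono q1 q2 G H Y : q1 <= q2 <= 1 ->
  lmi_constraints q1 G H Y -> exists H', lmi_constraints q2 G H' Y.
Proof.
move=> /andP[q12 q21] [[G0 Y0] trY YG GH qcq1].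
have qcq2 : qc < q2 <= 1.
  by case/andP: qcq1 => /lt_le_trans/(_ q12) -> _.
have /(Gamma_feasibleP Q_pd R_pd (supercritical01 qcq1) G0) gG :
  exists H, pdmx (Gamma A C Q R q1 G H) by exists H.
have /(Gamma_feasibleP Q_pd R_pd (supercritical01 qcq2) G0)[H' GH'] :
    riccati q2 (invmx G) <L invmx G.
  by apply: lemx_ltmx_trans gG; apply: riccati_anti => //; exact/pdmxW/pdmx_inv.
by exists H'.
Qed.

Lemma lmi_quasi_convexP : lmi_quasi_convex A C Q R qc gamma.
Proof.
have t01 (l : {i01 F}) : 0 <= l%:num <= 1 by rewrite ge0 le1.
split=> [q [[G1 H1] Y1] [[G2 H2] Y2] l|t [G1 Y1] [G2 Y2] l]; rewrite !inE/=.
  exact: lmi_constraints_conv.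
move=> [q1 [H1 [q1t L1]]] [q2 [H2 [q2t L2]]].
pose q := Num.max q1 q2.
have qt : q <= t by rewrite ge_max q1t.
have q_le1 : q <= 1.
  case: L1 L2 => _ _ _ _ /andP[_ q11] [_ _ _ _ /andP[_ q21]].
  by rewrite ge_max q11.
have [K1 M1] : exists H', lmi_constraints q G1 H' Y1.
  by apply: lmi_constraints_mono L1; rewrite le_max lexx.
have [K2 M2] : exists H', lmi_constraints q G2 H' Y2.
  by apply: lmi_constraints_mono L2; rewrite le_max lexx orbT.
exists q, (l%:num *: K1 + (1 - l%:num) *: K2); split=> //.
exact: lmi_constraints_conv.
Qed.

End Optimization.

Theorem theorem13 (F : realType) (n p : nat)
    (A : 'M[F]_n) (C : 'M[F]_(p, n)) (Q : 'M[F]_n) (R : 'M[F]_p)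
    (qc gamma : F)
    (hQ : pdmx Q) (hR : pdmx R) (hgamma : 0 < gamma)
    (hctrl : controllable A (sqrtmx Q)) (hdet : detectable A C)
    (hqc : is_critical_value A C Q R qc) :
  [/\ lmi_quasi_convex A C Q R qc gamma,
      forall qopt : F, is_solution (trace_feasible A C Q R qc gamma) qopt ->
        optimal_value (lmi_feasible A C Q R qc gamma) = qopt
    & lmi_feasible A C Q R qc gamma !=set0 ->
        optimal_value (lmi_feasible A C Q R qc gamma) =
        optimal_value (trace_feasible A C Q R qc gamma)].
Proof.
split.
- exact: lmi_quasi_convexP.
- by move=> qopt; exact: solution_lmi.
- exact: optimal_value_lmi.
Qed.
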